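(* Suppose that for every $(\theta,s)\in\Theta\times\{0,1,\dots,S\}$ the equation $\Phi_n(\theta,u_s,\pi)=0$ has a unique solution $\pi\in\Pi$. Then, for any $s\in\{1,\dots,S\}$, $$\Theta_n^{(s)}=\Theta_{\mathrm{II},n}^{(s)},$$ i.e. the set of SwiZs solutions equals the set of indirect inference solutions.
   Context: Setting: $\Theta,\Pi\subset\mathbb{R}^p$ are parameter sets. Data are generated as $x=g(\theta,u)$, where $u$ follows a known distribution $F_u$ not depending on $\theta$. For an estimating function $\psi$ with values in $\mathbb{R}^p$, put $\Phi_n(\theta,u,\pi)=\frac1n\sum_{i=1}^n\psi(g(\theta,u_{i}),\pi)$ where $u=(u_{1},\dots,u_{n})$. $\theta_0\in\Theta$ is the true parameter, $u_0$ is the realization of $u$ that generated the observed sample, and $u_1,\dots,u_S$ are simulated realizations of $u$. $\operatorname{argzero}$ denotes the set of all zeros of the given function on the given set. Auxiliary estimator: $\hat\pi_n\in\Pi_n=\operatorname{argzero}_{\pi\in\Pi}\Phi_n(\theta_0,u_0,\pi)$. SwiZs: $\Theta_n^{(s)}=\operatorname{argzero}_{\theta\in\Theta}\Phi_n(\theta,u_s,\hat\pi_n)$, $s=1,\dots,S$. Indirect inference estimators: for $\theta\in\Theta$, $\hat\pi^{(s)}_{\mathrm{II},n}(\theta)\in\operatorname{argzero}_{\pi\in\Pi}\Phi_n(\theta,u_s,\pi)$, and $\Theta^{(s)}_{\mathrm{II},n}=\operatorname{argzero}_{\theta\in\Theta}d\big(\hat\pi_n,\hat\pi^{(s)}_{\mathrm{II},n}(\theta)\big)$,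 where $d$ is a metric. *)

(* Defs.v *)
From mathcomp Require Import all_boot all_order all_algebra.
From mathcomp Require Import boolp classical_sets reals.

Set Implicit Arguments.
Unset Strict Implicit.
Unset Printing Implicit Defensive.

Import Order.TTheory GRing.Theory Num.Theory.
Local Open Scope classical_set_scope.
Local Open Scope ring_scope.

Definition argzero (T : Type) (V : zmodType) (D : set T) (f : T -> V) : set T :=
  [set x | D x /\ f x = 0].

(* Only the values of [d] on [D * D] matter, so that [d] ranges over all the
   metrics on the set [D], not only over the restrictions to [D] of a fixed
   metric of the ambient type. *)
Definition metric_on (R : realType) (T : Type) (D : set T) (d : T -> T -> R) :
    Prop :=
  [/\ forall x y, D x -> D y -> 0 <= d x y,
      forall x y, D x -> D y -> (d x y = 0 <-> x = y),
      forall x y, D x -> D y -> d x y = d y x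
    & forall x y z, D x -> D y -> D z -> d x z <= d x y + d y z].

(* [U] is the space of the individual random terms, [X] that of the
   observations; [g theta u_i] is the observation generated by the term [u_i]
   under the parameter [theta]. *)
Definition Phi (R : realType) (p n : nat) (U X : Type)
    (g : 'rV[R]_p -> U -> X) (psi : X -> 'rV[R]_p -> 'rV[R]_p)
    (theta : 'rV[R]_p) (u : 'I_n -> U) (pi : 'rV[R]_p) : 'rV[R]_p :=
  n%:R^-1 *: \sum_(i < n) psi (g theta (u i)) pi.

Definition SwiZs (R : realType) (p n : nat) (U X : Type)
    (Theta : set 'rV[R]_p)
    (g : 'rV[R]_p -> U -> X) (psi : X -> 'rV[R]_p -> 'rV[R]_p)
    (u : 'I_n -> U) (pihat : 'rV[R]_p) : set 'rV[R]_p :=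
  argzero Theta (fun theta => Phi g psi theta u pihat).

(* [piII theta] is the auxiliary estimator computed on the sample simulated
   under [theta]. *)
Definition indirect_inference (R : realType) (p : nat)
    (Theta : set 'rV[R]_p) (d : 'rV[R]_p -> 'rV[R]_p -> R)
    (pihat : 'rV[R]_p) (piII : 'rV[R]_p -> 'rV[R]_p) : set 'rV[R]_p :=
  argzero Theta (fun theta => d pihat (piII theta)).

(* Main.v *)
Require Import Defs.
From mathcomp Require Import all_boot all_order all_algebra.
From mathcomp Require Import boolp classical_sets reals.

Set Implicit Arguments.
Unset Strict Implicit.
Unset Printing Implicit Defensive.

Import Order.TTheory GRing.Theory Num.Theory.
Local Open Scope classical_set_scope.
Local Open Scope ring_scope.

(** Both estimators read the same equation [Phi g psi theta (u s) pi = 0]: SwiZs fixes [pi] at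
    [pihat] and solves for [theta], while indirect inference solves for [pi] at each [theta] and
    then matches the root [piII s theta] with [pihat]. As [d] separates the points of [Pi], a match
    means [pihat = piII s theta], which by uniqueness of the root amounts to [pihat] solving the
    equation at [theta]. *)

Theorem theorem5 (R : realType) (p n S : nat) (hn : (0 < n)%N)
    (Theta Pi : set 'rV[R]_p)
    (U X : Type) (g : 'rV[R]_p -> U -> X)
    (psi : X -> 'rV[R]_p -> 'rV[R]_p)
    (d : 'rV[R]_p -> 'rV[R]_p -> R) (hd : metric_on Pi d)
    (theta0 : 'rV[R]_p) (htheta0 : Theta theta0)
    (u : 'I_S.+1 -> 'I_n -> U)
    (pihat : 'rV[R]_p)
    (hpihat : argzero Pi (Phi g psi theta0 (u ord0)) pihat)
    (piII : 'I_S.+1 -> 'rV[R]_p -> 'rV[R]_p)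
    (hpiII : forall (s : 'I_S.+1) (theta : 'rV[R]_p), (0 < s)%N ->
       Theta theta -> argzero Pi (Phi g psi theta (u s)) (piII s theta))
    (huniq : forall (theta : 'rV[R]_p) (s : 'I_S.+1), Theta theta ->
       exists! pi : 'rV[R]_p, Pi pi /\ Phi g psi theta (u s) pi = 0) :
  forall s : 'I_S.+1, (0 < s)%N ->
    SwiZs Theta g psi (u s) pihat = indirect_inference Theta d pihat (piII s).
Proof.
(* [d] is a metric on [Pi] only, so separating points requires [pihat] to lie in [Pi]. *)
move=> s s_gt0; have [Pi_pihat _] := hpihat; case: hd => _ d_eq0 _ _.
apply/seteqP; split=> theta [Theta_theta zero_theta]; split=> //;
  have [Pi_piII Phi_piII] := hpiII s theta s_gt0 Theta_theta.
(* Here [pihat] and [piII s theta] are both roots in [Pi] for the sample simulated under [theta], so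
   both equal the unique root [pi]. *)
- have [pi [_ pi_uniq]] := huniq theta s Theta_theta.
  apply/(d_eq0 _ _ Pi_pihat Pi_piII).
  by rewrite -(pi_uniq pihat) // -(pi_uniq (piII s theta)).
(* Zero distance identifies [pihat] with [piII s theta], a root by construction. *)
- by have /(d_eq0 _ _ Pi_pihat Pi_piII) -> := zero_theta.
Qed.
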